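(* Consider a random forest classifier with decision trees $T_1,\ldots,T_n$ and classes $c_1,\ldots,c_k$, and let RFClassFormula be the sorting-network-based algorithm defined in the context. The algorithm works for any number $k$ of classes and any number $n$ of decision trees: for every $i\in\{1,\ldots,k\}$, $\mathrm{RFClassFormula}(T,n,c,k,i)$ returns a class formula $R^i$ of the random forest for class $c_i$. If the class formulas of the decision trees (and their negations) passed to it are NNF circuits, then the returned class formula is an NNF circuit. The class formulas it generates have size $O(S+nk\log^2(n))$, where $n$ is the number of decision trees, $k$ is the number of classes, and $S$ is the total size of the class formulas for the decision trees.
   Context: Features are discrete variables, each with a finite set of at least two states. A literal of a variable $X$ is a nonempty proper subset of the states of $X$ (true when the state of $X$ lies in it). An instance assigns one state to each variable. An NNF circuit is a circuit with only literals (and the constants true, false), conjunctions and disjunctions, with no negations; subcircuits may be shared, and its size is its number of nodes. Each decision tree $T_l$ assigns exactly one class to every instance. The class formula $C^j_l$ of tree $T_l$ for class $c_j$ is a formula over the features satisfied by exactly the instances that $T_l$ assigns to $c_j$. Both $C^j_l$ and $\neg C^j_l$ can be obtained as NNF circuits from $T_l$ in linear time, and the NNF circuit used for $\neg C^j_l$ has size linear in that of $C^j_l$ (for instance, push the negation to the literals). The random forest classifies by voting: each tree votes for the class it assigns to the instance, and the instance belongs to every class that receives the most votes (so with ties it may belong to several classes). The class formula $R^i$ of the random forest is a formula satisfied by exactly the instances that belong to $c_i$. Procedure $\mathrm{Merge}(A,B,m)$, for lists of circuits $A[1..m]$, $B[1..m]$ with $m$ a power of 2: if $m=1$, return $[A[1]\vee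 B[1],\ A[1]\wedge B[1]]$. Otherwise let $A_1,B_1$ be the sublists of odd-indexed elements and $A_2,B_2$ the sublists of even-indexed elements of $A,B$; let $C=\mathrm{Merge}(A_1,B_1,m/2)$ and $D=\mathrm{Merge}(A_2,B_2,m/2)$; return the list $y$ that starts with $C[1]$, followed for $i=2,\ldots,m$ by $C[i]\vee D[i-1]$ and $C[i]\wedge D[i-1]$, and finally $D[m]$. Procedure $\mathrm{Sortnet}(x,n)$, for a list of circuits $x[1..n]$ with $n$ a power of 2 (odd-even sorting network): if $n=1$, return $x$. Otherwise let $m=n/2$, $A=\mathrm{Sortnet}(x[1..m],m)$, $B=\mathrm{Sortnet}(x[m+1..n],m)$, and return $\mathrm{Merge}(A,B,m)$. Algorithm $\mathrm{RFClassFormula}(T,n,c,k,i)$: let $m$ be the smallest power of 2 no less than $n$. - If $k=2$: set $x[l]=C^i_l$ for $1\le l\le n$ and $x[l]=$ false for $n<l\le m$, and return the $\lceil n/2\rceil$-th output of $\mathrm{Sortnet}(x,m)$. - Otherwise: start with $R^i=$ true. For each $j\in\{1,\ldots,k\}$ with $j\ne i$: let $x$ be the list of length $2m$ consisting of $\neg C^j_1, C^i_1, \neg C^j_2, C^i_2,\ldots,\neg C^j_n, C^i_n$ followed by $2(m-n)$ copies of false, and replace $R^i$ by $R^i\wedge y_n$, where $y_n$ is the $n$-th output of $\mathrm{Sortnet}(x,2m)$. Return $R^i$. *)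

(* Defs.v *)
From mathcomp Require Import all_boot.

Set Implicit Arguments.
Unset Strict Implicit.
Unset Printing Implicit Defensive.

Local Open Scope nat_scope.

(** ** Features, instances, literals *)

Definition instance (V : finType) (D : V -> finType) := forall X : V, D X.

Record literal (V : finType) (D : V -> finType) := Literal {
  lit_var : V;
  lit_states : {set D lit_var};
  lit_proper : (lit_states != set0) && (lit_states != setT) }.

Definition lit_holds (V : finType) (D : V -> finType)
    (w : instance D) (a : literal D) :=
  w (lit_var a) \in lit_states a.

(** ** Circuits

    A [dag] is a list of gates in topological order: the gate at position [p]
    (the node [p]) may only refer to nodes [q < p].  A circuit is a node [p] of
    a [dag], namely the part of the [dag] below [p]; distinct circuits living
    in the same [dag] may share nodes.  The same gate may well occur at several
    nodes: nodes are never identified implicitly. *)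

Inductive gate (V : finType) (D : V -> finType) :=
| GTrue
| GFalse
| GLit of literal D
| GNot of nat
| GAnd of seq nat
| GOr of seq nat.
Arguments GTrue {V D}.
Arguments GFalse {V D}.
Arguments GNot {V D}.
Arguments GAnd {V D}.
Arguments GOr {V D}.

Definition dag (V : finType) (D : V -> finType) := seq (gate D).

Definition args (V : finType) (D : V -> finType) (g : gate D) : seq nat :=
  match g with
  | GTrue | GFalse | GLit _ => [::]
  | GNot p => [:: p]
  | GAnd ps | GOr ps => ps
  end.

Definition is_not (V : finType) (D : V -> finType) (g : gate D) :=
  if g is GNot _ then true else false.

Definition wf (V : finType) (D : V -> finType) (s : dag D) : Prop :=
  forall p, p < size s -> all (fun q => q < p) (args (nth GFalse s p)).

(** The list of values attached to the nodes, where the value of a node is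
    computed from its gate and the list of values of the preceding nodes. *)
Definition sweep (V : finType) (D : V -> finType) A (f : seq A -> gate D -> A)
    (s : dag D) : seq A :=
  foldl (fun v g => rcons v (f v g)) [::] s.

Definition gate_val (V : finType) (D : V -> finType) (w : instance D)
    (v : seq bool) (g : gate D) : bool :=
  match g with
  | GTrue => true
  | GFalse => false
  | GLit a => lit_holds w a
  | GNot p => ~~ nth false v p
  | GAnd ps => all (nth false v) ps
  | GOr ps => has (nth false v) ps
  end.

Definition sat (V : finType) (D : V -> finType)
    (s : dag D) (w : instance D) (p : nat) :=
  nth false (sweep (gate_val w) s) p.

(** [gate_nodes v g] is for the next node, whose number is [size v]. *)
Definition gate_nodes (V : finType) (D : V -> finType)
    (v : seq (seq nat)) (g : gate D) : seq nat :=
  undup (size v :: flatten [seq nth [::] v q | q <- args g]).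

(** The duplicate-free list of the nodes of the circuit [p]: [p] itself and
    every node that can be reached from it. *)
Definition nodes (V : finType) (D : V -> finType)
    (s : dag D) (p : nat) : seq nat :=
  nth [::] (sweep (@gate_nodes V D) s) p.

Definition csize (V : finType) (D : V -> finType) (s : dag D) (p : nat) : nat :=
  size (nodes s p).

Definition is_nnf (V : finType) (D : V -> finType)
    (s : dag D) (p : nat) : bool :=
  all (fun q => ~~ is_not (nth GFalse s q)) (nodes s p).

(** ** Decision trees and random forests *)

(** A test on [X] sends every state of [X] to a subtree; a test whose edges
    carry sets of states sends all states of a set to the same subtree. *)
Inductive dtree (V : finType) (D : V -> finType) (k : nat) :=
| Leaf of 'I_k
| Test (X : V) of (D X -> dtree D k).

Fixpoint classify (V : finType) (D : V -> finType)
    k (t : dtree D k) (w : instance D)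
    : 'I_k :=
  match t with
  | Leaf c => c
  | Test X f => classify (f (w X)) w
  end.

Definition votes (V : finType) (D : V -> finType) n k (T : 'I_n -> dtree D k)
    (w : instance D) (j : 'I_k) : nat :=
  #|[set l | classify (T l) w == j]|.

Definition belongs (V : finType) (D : V -> finType) n k (T : 'I_n -> dtree D k)
    (w : instance D) (i : 'I_k) : bool :=
  [forall j, votes T w j <= votes T w i].

(** The circuit [p] of [s] is satisfied exactly by the instances in [P]. *)
Definition formula_of (V : finType) (D : V -> finType) (s : dag D) (p : nat)
    (P : instance D -> bool) : Prop :=
  p < size s /\ forall w, sat s w p = P w.

(** ** Sorting networks

    The procedures below receive the current [dag], extend it at its end with
    the gates they create, and denote circuits by their nodes. *)

Definition push (V : finType) (D : V -> finType)
    (s : dag D) (g : gate D) : dag D * nat :=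
  (rcons s g, size s).

(** For each pair [(p, q)], in order, the outputs [p \/ q] and [p /\ q]. *)
Fixpoint comparators (V : finType) (D : V -> finType)
    (s : dag D) (ps : seq (nat * nat))
    : dag D * seq nat :=
  match ps with
  | [::] => (s, [::])
  | (p, q) :: ps' =>
      let: (s1, o) := push s (GOr [:: p; q]) in
      let: (s2, a) := push s1 (GAnd [:: p; q]) in
      let: (s3, y) := comparators s2 ps' in
      (s3, [:: o, a & y])
  end.

(** Elements of odd, resp. even, index in the 1-based numbering, for a list of
    length [2 * m]. *)
Definition odds (m : nat) (x : seq nat) : seq nat :=
  mkseq (fun t => nth 0 x t.*2) m.
Definition evens (m : nat) (x : seq nat) : seq nat :=
  mkseq (fun t => nth 0 x t.*2.+1) m.

(** Merge of two lists of length [m = 2 ^ e].  In the recursive case [C] and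
    [E] have length [m], so that [zip (behead C) E] lists the pairs of the
    [t]-th element of [C] and the [t-1]-th element of [E], for [1 < t <= m]. *)
Fixpoint oe_merge (V : finType) (D : V -> finType)
    (e : nat) (s : dag D) (A B : seq nat)
    : dag D * seq nat :=
  match e with
  | 0 => comparators s [:: (nth 0 A 0, nth 0 B 0)]
  | e'.+1 =>
      let: (s1, C) := oe_merge e' s (odds (2 ^ e') A) (odds (2 ^ e') B) in
      let: (s2, E) := oe_merge e' s1 (evens (2 ^ e') A) (evens (2 ^ e') B) in
      let: (s3, y) := comparators s2 (zip (behead C) E) in
      (s3, nth 0 C 0 :: rcons y (nth 0 E (2 ^ e).-1))
  end.

(** Sorting of a list of length [2 ^ e]. *)
Fixpoint sortnet (V : finType) (D : V -> finType)
    (e : nat) (s : dag D) (x : seq nat)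
    : dag D * seq nat :=
  match e with
  | 0 => (s, x)
  | e'.+1 =>
      let: (s1, A) := sortnet e' s (take (2 ^ e') x) in
      let: (s2, B) := sortnet e' s1 (drop (2 ^ e') x) in
      oe_merge e' s2 A B
  end.

(** ** Class formulas of random forests

    [C j l] and [N j l] are the nodes of the circuits for the class formula of
    the [l]-th tree for the [j]-th class and for its negation. *)

Definition rf_two (V : finType) (D : V -> finType) n k (s : dag D)
    (C : 'I_k -> 'I_n -> nat) (i : 'I_k) : dag D * nat :=
  let e := up_log 2 n in
  let: (s1, f) := push s GFalse in
  let x := [seq C i l | l <- enum 'I_n] ++ nseq (2 ^ e - n) f in
  let: (s2, y) := sortnet e s1 x in
  (s2, nth 0 y (uphalf n).-1).

(** The conjunction with the circuit [r] of the circuits stating that class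
    [i] gets at least as many votes as [j], for [j] in [js]; [f] is a node for
    the constant false. *)
Fixpoint rf_loop (V : finType) (D : V -> finType)
    n k (C N : 'I_k -> 'I_n -> nat)
    (i : 'I_k) (f : nat) (js : seq 'I_k) (s : dag D) (r : nat) : dag D * nat :=
  match js with
  | [::] => (s, r)
  | j :: js' =>
      let e := up_log 2 n in
      let x := flatten [seq [:: N j l; C i l] | l <- enum 'I_n]
               ++ nseq (2 * (2 ^ e - n)) f in
      let: (s1, y) := sortnet e.+1 s x in
      let: (s2, r') := push s1 (GAnd [:: r; nth 0 y n.-1]) in
      rf_loop C N i f js' s2 r'
  end.

Definition RFClassFormula (V : finType) (D : V -> finType) n k (s : dag D)
    (C N : 'I_k -> 'I_n -> nat) (i : 'I_k) : dag D * nat :=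
  if k == 2 then rf_two s C i
  else
    let: (s1, f) := push s GFalse in
    let: (s2, r) := push s1 GTrue in
    rf_loop C N i f [seq j <- enum 'I_k | j != i] s2 r.

(* Main.v *)
Require Import Defs.
From HB Require Import structures.
From mathcomp Require Import all_boot all_order all_algebra.
From mathcomp Require Import reals exp.
From mathcomp Require Import zify lra.

Set Implicit Arguments.
Unset Strict Implicit.
Unset Printing Implicit Defensive.

Import Order.TTheory GRing.Theory Num.Theory.

(** A fixed instance turns the circuits into booleans, so sorting reduces to
    counting: if [a] and [b] inputs of a merge are true, its two recursive calls
    see [uphalf a + uphalf b] and [a./2 + b./2] true inputs, numbers that differ
    by at most [2], and the final row of comparators repairs the interleaving.
    The [n]-th output for class [j] thus says [n - votes j + votes i >= n].

    The circuit of the result only reaches new gates and nodes of the given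
    circuits.  With [e = up_log 2 n] there are at most
    [k (2^(e+1) (e+1)^2 + 1) + 2] new gates, where [2^e <= 2n] and
    [e + 1 <= 2 + 2 ln n]; the terms without logarithm (all there is for
    [n = 1]) are absorbed by [S], which is at least [n k]. *)

(** * Values and reachable nodes of a dag extended by one gate *)

Section Sweep.
Variables (V : finType) (D : V -> finType).
Implicit Types (s : dag D) (w : instance D).

Lemma sweep_rcons A (f : seq A -> gate D -> A) s g :
  sweep f (rcons s g) = rcons (sweep f s) (f (sweep f s) g).
Proof. by rewrite /sweep foldl_rcons. Qed.

Lemma size_sweep A (f : seq A -> gate D -> A) s : size (sweep f s) = size s.
Proof.
by elim/last_ind: s => // s g IHs; rewrite sweep_rcons !size_rcons IHs.
Qed.

Lemma sat_rcons s g w p : p < size s -> sat (rcons s g) w p = sat s w p.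
Proof. by move=> lt_p; rewrite /sat sweep_rcons nth_rcons size_sweep lt_p. Qed.

Lemma sat_last s g w :
  sat (rcons s g) w (size s) = gate_val w (sweep (gate_val w) s) g.
Proof.
by rewrite /sat sweep_rcons nth_rcons size_sweep ltnn eqxx.
Qed.

Lemma nodes_rcons s g p : p < size s -> nodes (rcons s g) p = nodes s p.
Proof. by move=> lt_p; rewrite /nodes sweep_rcons nth_rcons size_sweep lt_p. Qed.

Lemma nodes_last s g :
  nodes (rcons s g) (size s) =
  undup (size s :: flatten [seq nodes s q | q <- args g]).
Proof.
by rewrite /nodes sweep_rcons nth_rcons size_sweep ltnn eqxx /gate_nodes
           size_sweep.
Qed.

(** With this, including [nodes s p] in a list bounds [csize s p] by the length of that list. *)
Lemma uniq_nodes s p : uniq (nodes s p).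
Proof.
elim/last_ind: s => [|s g IHs]; first by rewrite /nodes nth_nil.
have [lt_p|] := ltnP p (size s); first by rewrite nodes_rcons.
rewrite leq_eqVlt => /orP[/eqP <-|lt_p]; first by rewrite nodes_last undup_uniq.
by rewrite /nodes nth_default // size_sweep size_rcons.
Qed.

Lemma self_in_nodes s p : p < size s -> p \in nodes s p.
Proof.
elim/last_ind: s => // s g IHs; rewrite size_rcons ltnS leq_eqVlt.
case/orP=> [/eqP ->|lt_p]; last by rewrite nodes_rcons ?IHs.
by rewrite nodes_last mem_undup mem_head.
Qed.

Lemma csize_gt0 s p : p < size s -> 0 < csize s p.
Proof.
by move=> /self_in_nodes; rewrite /csize; case: (nodes s p).
Qed.

End Sweep.

(** * Extensions of a dag by negation-free gates over usable nodes *)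

Section Growth.
Variables (V : finType) (D : V -> finType).
(* [m] is the size of the initial dag and [Q] selects those of its nodes that
   new gates may refer to. *)
Variables (m : nat) (Q : pred nat).
Implicit Types (s : dag D) (w : instance D).

(** The initial dag may hold nodes outside the given circuits. Restricting old arguments to [Q]
    keeps those nodes out of the result, and hence out of its size. *)
Definition usable s p := (p < size s) && ((m <= p) || Q p).

(** One invariant serves all the procedures: old values are kept, well-formedness is preserved, no
    negation is added, and what a new gate reaches is controlled. *)
Inductive grow s : dag D -> Prop :=
| GrowRefl : grow s s
| GrowPush s' g of grow s s' & ~~ is_not g & all (usable s') (args g) :
    grow s (rcons s' g).

Lemma grow_trans s1 s2 s3 : grow s1 s2 -> grow s2 s3 -> grow s1 s3.
Proof. by move=> g12; elim=> // s' g _ g1s' ng gg; apply: GrowPush. Qed.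

Lemma grow_push s g : ~~ is_not g -> all (usable s) (args g) ->
  grow s (rcons s g).
Proof. by apply: GrowPush; apply: GrowRefl. Qed.

Lemma leq_grow s s' : grow s s' -> size s <= size s'.
Proof. by elim=> // {}s' g _ le_s _ _; rewrite size_rcons ltnW. Qed.

Lemma sat_grow s s' w p : grow s s' -> p < size s -> sat s' w p = sat s w p.
Proof.
move=> + lt_p; elim=> // {}s' g gs <- _ _; rewrite sat_rcons //.
exact: leq_trans lt_p (leq_grow gs).
Qed.

Lemma usable_grow s s' p : grow s s' -> usable s p -> usable s' p.
Proof.
by move=> /leq_grow le_s /andP[lt_p okp]; rewrite /usable okp (leq_trans lt_p).
Qed.

Lemma all_usable_grow s s' x :
  grow s s' -> all (usable s) x -> all (usable s') x.
Proof. by move=> gs; apply: sub_all => p; apply: usable_grow. Qed.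

Lemma usable_nth s x t : all (usable s) x -> t < size x -> nth 0 x t < size s.
Proof. by move=> /(all_nthP 0) okx /okx /andP[]. Qed.

Lemma map_sat_grow s s' w x : grow s s' -> all (usable s) x ->
  map (sat s' w) x = map (sat s w) x.
Proof.
move=> gs /allP okx; apply/eq_in_map => p /okx/andP[lt_p _].
exact: sat_grow.
Qed.

Lemma wf_grow s s' : grow s s' -> wf s -> wf s'.
Proof.
move=> + wfs; elim=> // {}s' g _ wfs' _ okg p.
rewrite size_rcons ltnS nth_rcons leq_eqVlt.
case/orP=> [/eqP ->|lt_p]; last by rewrite lt_p; apply: wfs'.
by rewrite ltnn eqxx; apply: sub_all okg => q /andP[].
Qed.

(** New gates are never negations, and neither is the default [GFalse] read past the end, so a
    negation can only be an old gate. This reduces the NNF claim to the given circuits. *)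
Lemma gate_grow s s' p : grow s s' -> is_not (nth GFalse s' p) ->
  p < size s /\ is_not (nth GFalse s p).
Proof.
elim=> [|{}s' g gs IHs ng _].
  by have [//|le_p] := ltnP p (size s); rewrite nth_default.
rewrite nth_rcons; case: ltngtP => // _.
by rewrite (negPf ng).
Qed.

Lemma usable_push s g : m <= size s -> usable (rcons s g) (size s).
Proof. by move=> le_m; rewrite /usable size_rcons ltnSn le_m. Qed.

(** By induction on the growth: a new node reaches itself and what its usable arguments reach. The
    size of a result is thus at most the length of [L] plus the number of new gates. *)
Lemma nodes_bound s s' (L : seq nat) p : size s = m ->
    (forall q, q < m -> Q q -> {subset nodes s q <= L}) ->
  grow s s' -> usable s' p ->
  {subset nodes s' p <= L ++ iota m (size s' - m)}.
Proof.
move=> sz_s QL gs; elim: gs p => [|{}s' g gs IHs _ okg] p.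
  case/andP=> lt_p okp q q_p; rewrite mem_cat (QL p) // -?sz_s //.
  by case/orP: okp => // le_p; rewrite ltnNge sz_s le_p in lt_p.
have le_m := leq_grow gs; rewrite sz_s in le_m.
have incl q: q \in L ++ iota m (size s' - m) ->
    q \in L ++ iota m ((size s').+1 - m).
  by rewrite !mem_cat !mem_iota => /orP[->//|?];
     apply/orP; right; lia.
case/andP; rewrite size_rcons ltnS leq_eqVlt.
case/orP=> [/eqP -> _|lt_p okp] q; last first.
  by rewrite nodes_rcons // => q_p; apply: incl (IHs p _ _ q_p);
     rewrite /usable lt_p.
rewrite nodes_last mem_undup inE => /orP[/eqP ->|].
  by rewrite mem_cat mem_iota; apply/orP; right; lia.
case/flattenP=> _ /mapP[r /(allP okg) okr ->] /(IHs r okr).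
exact: incl.
Qed.

(** * Comparators and odd-even merging *)

Lemma comparatorsP s ps : m <= size s ->
    all (fun u => usable s u.1 && usable s u.2) ps ->
  let: (s', y) := comparators s ps in
  [/\ grow s s', size s' = size s + (size ps).*2, size y = (size ps).*2,
      all (usable s') y
    & forall w t, t < size ps ->
        let u := nth (0, 0) ps t in
        (sat s' w (nth 0 y t.*2) = sat s w u.1 || sat s w u.2) *
        (sat s' w (nth 0 y t.*2.+1) = sat s w u.1 && sat s w u.2)].
Proof.
elim: ps s => [|[p q] ps IHps] s le_m /=.
  by split=> //; rewrite ?addn0 //; apply: GrowRefl.
case/andP=> /andP[okp okq] okps.
set s1 := rcons s _; set s2 := rcons s1 _.
have g1: grow s s1 by apply: grow_push => //=; rewrite okp okq.
have g2: grow s1 s2.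
  by apply: grow_push => //=; rewrite !(usable_grow g1) ?okp ?okq.
have g02 := grow_trans g1 g2.
have sz1: size s1 = (size s).+1 by rewrite size_rcons.
have sz2: size s2 = (size s).+2 by rewrite size_rcons sz1.
have le_m2: m <= size s2 by apply: leq_trans (leq_grow g02).
have okps2: all (fun u => usable s2 u.1 && usable s2 u.2) ps.
  apply: sub_all okps => u /andP[ok1 ok2].
  by rewrite !(usable_grow g02).
have {IHps} := IHps s2 le_m2 okps2.
case: (comparators s2 ps) => s3 y [g3 sz3 szy oky valy]; split.
- exact: grow_trans g3.
- by rewrite sz3 sz2 doubleS !addnS.
- by rewrite /= szy.
- have ok_o: usable s2 (size s).
    by apply: (usable_grow g2); apply: usable_push.
  have ok_a: usable s2 (size s1).
    by apply: usable_push; apply: leq_trans (leq_grow g1).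
  by rewrite /= oky !(usable_grow g3).
- have [lt_p lt_q] : p < size s /\ q < size s.
    by case/andP: okp => -> _; case/andP: okq.
  move=> w [_|t] /=.
    have -> : sat s3 w (size s) = sat s w p || sat s w q.
      rewrite (sat_grow w g3) ?sz2 // (sat_grow w g2) ?sz1 //.
      by rewrite sat_last /= orbF.
    have -> // : sat s3 w (size s1) = sat s w p && sat s w q.
    rewrite (sat_grow w g3); last by rewrite sz2 sz1.
    by rewrite sat_last /= andbT; congr (_ && _); apply: (sat_grow w g1).
  rewrite ltnS => lt_t; have /andP[/andP[lt1 _] /andP[lt2 _]] :=
    all_nthP (0, 0) okps t lt_t.
  by rewrite !valy // !(sat_grow _ g02).
Qed.

(** Under [w], the list is sorted with its [c] true values first, matching comparators that output
    the disjunction before the conjunction. The condition [c <= size x] makes [c] the exact number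
    of true values. *)
Definition threshold s w x c :=
  c <= size x /\ forall t, t < size x -> sat s w (nth 0 x t) = (t < c).

Lemma threshold_grow s s' w x c : grow s s' -> all (usable s) x ->
  threshold s w x c -> threshold s' w x c.
Proof.
move=> gs okx [le_c valx]; split=> // t lt_t.
by rewrite (sat_grow _ gs) ?valx // (usable_nth okx).
Qed.

(** Odd 1-based indices are the even 0-based ones, and [uphalf c] of these lie below [c]; hence the
    rounding up here and the rounding down for [evens]. *)
Lemma threshold_odds s w x c h : size x = h.*2 ->
  threshold s w x c -> threshold s w (odds h x) (uphalf c).
Proof.
move=> szx [le_c valx]; split=> [|t]; rewrite size_mkseq ?uphalfE; first by lia.
move=> lt_t; rewrite nth_mkseq // valx; first by apply/idP/idP; lia.
by rewrite szx ltn_double.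
Qed.

Lemma threshold_evens s w x c h : size x = h.*2 ->
  threshold s w x c -> threshold s w (evens h x) c./2.
Proof.
move=> szx [le_c valx]; split=> [|t]; rewrite size_mkseq; first by lia.
move=> lt_t; rewrite nth_mkseq // valx; first by apply/idP/idP; lia.
by rewrite szx ltn_Sdouble.
Qed.

Lemma usable_odds s x h : size x = h.*2 ->
  all (usable s) x -> all (usable s) (odds h x).
Proof.
move=> szx /(all_nthP 0) okx; apply/allP => _ /mapP[t t_h ->]; apply: okx.
by rewrite mem_iota in t_h; rewrite szx ltn_double.
Qed.

Lemma usable_evens s x h : size x = h.*2 ->
  all (usable s) x -> all (usable s) (evens h x).
Proof.
move=> szx /(all_nthP 0) okx; apply/allP => _ /mapP[t t_h ->]; apply: okx.
by rewrite mem_iota in t_h; rewrite szx ltn_Sdouble.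
Qed.

Lemma merge_headE a b : (0 < uphalf a + uphalf b) = (0 < a + b).
Proof. by case: a => [|a]; case: b. Qed.

(** Put [c = uphalf a + uphalf b] and [d = a./2 + b./2]. Then [c + d = a + b] and [d <= c <= d + 2].
    The disjunction holds iff [t] is below the maximum of [c - 1] and [d], the conjunction iff [t]
    is below their minimum; the cases [c - d = 0, 1, 2] give the two formulas. *)
Lemma merge_orE t a b :
  (t.+1 < uphalf a + uphalf b) || (t < a./2 + b./2) = (t.*2.+1 < a + b).
Proof. by rewrite !uphalfE; apply/idP/idP; lia. Qed.

Lemma merge_andE t a b :
  (t.+1 < uphalf a + uphalf b) && (t < a./2 + b./2) = (t.*2.+2 < a + b).
Proof. by rewrite !uphalfE; apply/idP/idP; lia. Qed.

(** Both sides force [a = b = h.*2]: the last output is true only if every input is. *)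
Lemma merge_lastE h a b : 0 < h -> a <= h.*2 -> b <= h.*2 ->
  (h.*2.-1 < a./2 + b./2) = (h.*2.-1.*2.+1 < a + b).
Proof. by move=> *; apply/idP/idP; lia. Qed.

(** Two recursive merges with [h] outputs each, then [h.-1] comparators of two gates. *)
Lemma merge_cost h e c0 c1 c2 : c1 <= c0 + h * e -> c2 <= c1 + h * e ->
  c2 + h.-1.*2 <= c0 + 2 * h * e.+1.
Proof. by rewrite mulnS -mulnA; move: (h * e) => u; lia. Qed.

Lemma oe_mergeP e s A B : m <= size s -> size A = 2 ^ e -> size B = 2 ^ e ->
    all (usable s) A -> all (usable s) B ->
  let: (s', y) := oe_merge e s A B in
  [/\ grow s s', size s' <= size s + 2 ^ e.+1 * e.+1, size y = 2 ^ e.+1,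
      all (usable s') y
    & forall w a b, threshold s w A a -> threshold s w B b ->
        threshold s' w y (a + b)].
Proof.
elim: e s A B => [|e IHe] s A B le_m szA szB okA okB.
  rewrite -[oe_merge 0 s A B]/(comparators s [:: (nth 0 A 0, nth 0 B 0)]).
  move def_ps: [:: (nth 0 A 0, nth 0 B 0)] => ps.
  have okps : all (fun u => usable s u.1 && usable s u.2) ps.
    by rewrite -def_ps /= !(all_nthP 0 _) ?szA ?szB.
  have := comparatorsP le_m okps.
  case: (comparators s ps) => s' y [gs szs szy oky valy].
  rewrite -def_ps in szs szy valy.
  split=> //; first by rewrite szs.
  move=> w a b [le_a /(_ 0) valA] [le_b /(_ 0) valB].
  rewrite szA in le_a valA; rewrite szB in le_b valB.
  have [val0 val1] := valy w 0 isT; rewrite /= valA // valB // in val0 val1.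
  split; rewrite szy; first by rewrite (leq_add le_a le_b).
  by case=> [|[|]] //= _; rewrite ?val0 ?val1; lia.
have eqp : 2 ^ e.+1 = (2 ^ e).*2 by rewrite expnS mul2n.
have [p_gt0 h_gt0] : 0 < 2 ^ e /\ 0 < 2 ^ e.+1 by rewrite !expn_gt0.
rewrite eqp in szA szB; rewrite /=.
have := IHe s (odds (2 ^ e) A) (odds (2 ^ e) B) le_m (size_mkseq _ _)
  (size_mkseq _ _) (usable_odds szA okA) (usable_odds szB okB).
case: (@oe_merge V D _ _ _ _) => s1 C [g1 sz1 szC okC valC].
have le_m1 : m <= size s1 := leq_trans le_m (leq_grow g1).
have okA1 := all_usable_grow g1 okA; have okB1 := all_usable_grow g1 okB.
have := IHe s1 (evens (2 ^ e) A) (evens (2 ^ e) B) le_m1 (size_mkseq _ _)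
  (size_mkseq _ _) (usable_evens szA okA1) (usable_evens szB okB1).
case: (@oe_merge V D _ _ _ _) => s2 E [g2 sz2 szE okE valE].
have okC2 := all_usable_grow g2 okC.
have le_m2 : m <= size s2 := leq_trans le_m1 (leq_grow g2).
set ps := zip _ _.
have szps : size ps = (2 ^ e.+1).-1.
  by rewrite size_zip size_behead szC szE; lia.
have nth_ps t : t < size ps -> nth (0, 0) ps t = (nth 0 C t.+1, nth 0 E t).
  by move=> lt_t; rewrite nth_zip_cond lt_t nth_behead.
have okps : all (fun u => usable s2 u.1 && usable s2 u.2) ps.
  apply/(all_nthP (0, 0)) => t lt_t; rewrite nth_ps //.
  by rewrite szps in lt_t; rewrite !(all_nthP 0 _) ?szC ?szE //; lia.
have := comparatorsP le_m2 okps.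
case: (@comparators V D _ _) => s3 y [g3 sz3 szy oky valy].
rewrite szps in sz3 szy valy nth_ps.
have g12 := grow_trans g1 g2; have g13 := grow_trans g12 g3.
have szr : size (nth 0 C 0 :: rcons y (nth 0 E (2 ^ e.+1).-1)) = 2 ^ e.+2.
  by rewrite /= size_rcons szy -doubleS prednK ?h_gt0 // -mul2n -expnS.
have okC0 : usable s2 (nth 0 C 0) by apply: (all_nthP 0 okC2); rewrite szC.
have okEl : usable s2 (nth 0 E (2 ^ e.+1).-1).
  by apply: (all_nthP 0 okE); rewrite szE prednK.
split=> //.
- by rewrite sz3 (expnS 2 e.+1); apply: merge_cost sz1 sz2.
- by rewrite /= all_rcons oky !(usable_grow g3).
move=> w a b tA tB.
have [le_a _] := tA; have [le_b _] := tB; rewrite szA in le_a.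
rewrite szB in le_b.
have [le_c tC] := valC w _ _ (threshold_odds szA tA) (threshold_odds szB tB).
have [tA1 tB1] := (threshold_grow g1 okA tA, threshold_grow g1 okB tB).
have [le_d tE] :=
  valE w _ _ (threshold_evens szA tA1) (threshold_evens szB tB1).
rewrite szC in tC; rewrite szE in tE.
have tC2 t : t < 2 ^ e.+1 -> sat s2 w (nth 0 C t) = (t < uphalf a + uphalf b).
  move=> lt_t; rewrite (sat_grow _ g2) ?tC //.
  by apply: usable_nth okC _; rewrite szC.
have lt_C0 : nth 0 C 0 < size s2 by case/andP: okC0.
have lt_El : nth 0 E (2 ^ e.+1).-1 < size s2 by case/andP: okEl.
split; first by rewrite szr expnS mul2n -addnn eqp leq_add.
rewrite szr => -[_|t] /=.
  by rewrite (sat_grow _ g3) // tC2 // merge_headE.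
rewrite (expnS 2 e.+1) mul2n => lt_t; rewrite nth_rcons szy.
have le_t : t <= (2 ^ e.+1).-1.*2.
  by rewrite -ltnS -(prednK h_gt0) doubleS in lt_t *.
case: ltngtP le_t => // [lt_ty|->] _; last first.
  rewrite (sat_grow _ g3) // tE; last by rewrite prednK.
  by rewrite eqp merge_lastE.
(* Entry [t] of [y] comes from comparator [t./2], as its disjunction for even [t] and its
   conjunction for odd [t]. The leading [C[1]] makes it output [t.+1] of the merge. *)
have lt_th : t./2 < (2 ^ e.+1).-1 by rewrite ltn_half_double.
have [val0 val1] := valy w _ lt_th.
have [lt_t0 lt_t1] : t./2 < 2 ^ e.+1 /\ t./2.+1 < 2 ^ e.+1.
  by rewrite -(prednK h_gt0) !ltnS ltnW.
rewrite nth_ps // /= tC2 // tE // in val0 val1.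
have := odd_double_half t; case: (odd t) => /= def_t.
  by rewrite -{1 2}def_t !add1n val1 merge_andE.
by rewrite -{1 2}def_t !add0n val0 merge_orE.
Qed.

(** * Correctness and cost of the sorting network *)

Lemma sortnet_cost h e c0 c1 c2 c3 : c1 <= c0 + h * e ^ 2 ->
  c2 <= c1 + h * e ^ 2 -> c3 <= c2 + 2 * h * e.+1 ->
  c3 <= c0 + 2 * h * e.+1 ^ 2.
Proof.
(* Two half-size sorts and one merge; the inequality rests on [e ^ 2 + e.+1 <= e.+1 ^ 2]. *)
by rewrite -!mulnn; nia.
Qed.

Lemma sortnetP e s x : m <= size s -> size x = 2 ^ e -> all (usable s) x ->
  let: (s', y) := sortnet e s x in
  [/\ grow s s', size s' <= size s + 2 ^ e * e ^ 2, size y = 2 ^ e,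
      all (usable s') y
    & forall w, threshold s' w y (count (sat s w) x)].
Proof.
elim: e s x => [|e IHe] s x le_m szx okx /=.
  split=> //; rewrite ?addn0 //; first exact: GrowRefl.
  move=> w; case: x szx {okx} => [//|p [|//]] _.
  by split=> [|[|//]] /=; case: (sat s w p).
have eqp : 2 ^ e.+1 = 2 ^ e + 2 ^ e by rewrite expnS mul2n addnn.
have szt : size (take (2 ^ e) x) = 2 ^ e.
  by rewrite size_takel // szx eqp leq_addr.
have szd : size (drop (2 ^ e) x) = 2 ^ e by rewrite size_drop szx eqp addnK.
have [okt okd] : all (usable s) (take (2 ^ e) x) /\
    all (usable s) (drop (2 ^ e) x).
  by apply/andP; rewrite -all_cat cat_take_drop.
have := IHe _ _ le_m szt okt.
case: (@sortnet V D _ _ _) => s1 A [g1 sz1 szA okA tA].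
have le_m1 : m <= size s1 := leq_trans le_m (leq_grow g1).
have := IHe _ _ le_m1 szd (all_usable_grow g1 okd).
case: (@sortnet V D _ _ _) => s2 B [g2 sz2 szB okB tB].
have le_m2 : m <= size s2 := leq_trans le_m1 (leq_grow g2).
have := oe_mergeP le_m2 szA szB (all_usable_grow g2 okA) okB.
case: (@oe_merge V D _ _ _ _) => s3 y [g3 sz3 szy oky ty].
split=> //.
- exact: grow_trans g1 (grow_trans g2 g3).
- by rewrite expnS in sz3 *; apply: sortnet_cost sz1 sz2 sz3.
move=> w; rewrite -[x in count _ x](cat_take_drop (2 ^ e)) count_cat.
apply: ty; first exact: threshold_grow (tA w).
(* The second half is sorted in the dag left by the first sort, where its values are unchanged. *)
by have := tB w; rewrite -!(count_map (sat _ _) id) (map_sat_grow _ g1).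
Qed.

(** * Vote counts and class formulas of the forest *)

Lemma count_vote_pairs n (P : pred nat) (f g : 'I_n -> nat) (ls : seq 'I_n) :
  count P (flatten [seq [:: f l; g l] | l <- ls]) =
  count (P \o f) ls + count (P \o g) ls.
Proof. by elim: ls => //= l ls ->; lia. Qed.

Lemma size_vote_pairs n (f g : 'I_n -> nat) (ls : seq 'I_n) :
  size (flatten [seq [:: f l; g l] | l <- ls]) = 2 * size ls.
Proof. by elim: ls => //= l ls ->; rewrite mulnS. Qed.

Lemma votes_count n k (T : 'I_n -> dtree D k) w j :
  votes T w j = count (fun l => classify (T l) w == j) (enum 'I_n).
Proof. by rewrite /votes cardsE cardE -size_filter {1}/enum_mem enumT. Qed.

Lemma votes_neq n k (T : 'I_n -> dtree D k) w j :
  votes T w j + count (fun l => classify (T l) w != j) (enum 'I_n) = n.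
Proof. by rewrite votes_count count_predC size_enum_ord. Qed.

Section Forest.
Variables (n k : nat) (T : 'I_n -> dtree D k) (C N : 'I_k -> 'I_n -> nat).
Hypothesis n_gt0 : 0 < n.
Local Arguments sortnet : simpl never.

Definition tree_formulas s :=
  [/\ forall j l, usable s (C j l), forall j l, usable s (N j l),
      forall j l w, sat s w (C j l) = (classify (T l) w == j)
    & forall j l w, sat s w (N j l) = (classify (T l) w != j)].

Lemma tree_formulas_grow s s' :
  grow s s' -> tree_formulas s -> tree_formulas s'.
Proof.
move=> gs [okC okN valC valN]; split=> j l; try exact: usable_grow gs _.
  by move=> w; have /andP[lt_C _] := okC j l; rewrite (sat_grow w gs).
by move=> w; have /andP[lt_N _] := okN j l; rewrite (sat_grow w gs).
Qed.

Lemma rf_loopP i f js s r : m <= size s -> usable s f -> usable s r ->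
    (forall w, sat s w f = false) -> tree_formulas s ->
  let: (s', r') := rf_loop C N i f js s r in
  let e := up_log 2 n in
  [/\ grow s s', size s' <= size s + size js * (2 ^ e.+1 * e.+1 ^ 2).+1,
      usable s' r'
    & forall w, sat s' w r' =
        sat s w r && all (fun j => votes T w j <= votes T w i) js].
Proof.
elim: js s r => [|j js IHjs] s r le_m okf okr valf Ts /=.
  by split=> // [||w]; rewrite ?addn0 ?andbT //; apply: GrowRefl.
have [okC okN valC valN] := Ts.
set e := up_log 2 n; have le_n : n <= 2 ^ e by apply: up_logP.
set x := _ ++ _.
have szx : size x = 2 ^ e.+1.
  by rewrite size_cat size_vote_pairs size_enum_ord size_nseq -mulnDr subnKC //
             expnS.
have okx : all (usable s) x.
  rewrite all_cat all_nseq okf orbT andbT; apply/allP => p.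
  by case/flattenP=> _ /mapP[l _ ->]; rewrite !inE => /orP[]/eqP->.
have cntx w : count (sat s w) x = n - votes T w j + votes T w i.
  rewrite count_cat count_nseq valf mul0n addn0 count_vote_pairs.
  rewrite (votes_count T w i).
  have -> : n - votes T w j =
      count (fun l => classify (T l) w != j) (enum 'I_n).
    by have := votes_neq T w j; lia.
  by congr (_ + _); apply: eq_count => l /=; rewrite ?valN ?valC.
have lt_n : n.-1 < 2 ^ e.+1.
  by rewrite prednK // expnS mul2n -addnn (leq_trans le_n) ?leq_addl.
have := sortnetP le_m szx okx.
case: (sortnet e.+1 s x) => s1 y [g1 sz1 szy oky ty] /=.
set s2 := rcons s1 _.
have oky1 : usable s1 (nth 0 y n.-1) by apply: (all_nthP 0 oky); rewrite szy.
have okr1 := usable_grow g1 okr.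
have g2 : grow s1 s2 by apply: grow_push => //=; rewrite okr1 oky1.
have g12 := grow_trans g1 g2.
have le_m1 : m <= size s1 := leq_trans le_m (leq_grow g1).
have le_m2 : m <= size s2 := leq_trans le_m1 (leq_grow g2).
have [lt_f lt_r] : f < size s /\ r < size s.
  by case/andP: okf => -> _; case/andP: okr.
have valf2 w : sat s2 w f = false by rewrite (sat_grow w g12).
have := IHjs s2 _ le_m2 (usable_grow g12 okf) (usable_push _ le_m1) valf2
  (tree_formulas_grow g12 Ts).
case: (rf_loop _ _ _ _ _ _ _) => s3 r3 [g3 sz3 okr3 val3]; split=> //.
- exact: grow_trans g12 g3.
- apply: leq_trans sz3 _; rewrite size_rcons mulSn addnA leq_add2r.
  by rewrite addnS ltnS.
move=> w; rewrite val3 sat_last /= andbT andbA; congr (_ && _).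
have -> : nth false (sweep (gate_val w) s1) r = sat s w r.
  exact: sat_grow.
congr (_ && _); have [_ /(_ n.-1)] := ty w; rewrite szy => /(_ lt_n).
rewrite /sat => ->; rewrite cntx prednK //.
(* As [votes T w j <= n], the subtraction in [cntx] is not truncated, so output [n.-1] (0-based) is
   true iff [j] has at most as many votes as [i]. *)
by have := votes_neq T w j; lia.
Qed.

Lemma rf_twoP i s : k = 2 -> m <= size s -> tree_formulas s ->
  let: (s', r) := rf_two s C i in
  let e := up_log 2 n in
  [/\ grow s s', size s' <= size s + (2 ^ e * e ^ 2).+1, usable s' r
    & forall w, sat s' w r = belongs T w i].
Proof.
move=> k2 le_m Ts; rewrite /rf_two /=.
set s1 := rcons s GFalse; set e := up_log 2 n; set x := _ ++ _.
have le_n : n <= 2 ^ e by apply: up_logP.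
have g1 : grow s s1 by apply: grow_push.
have [okC _ valC _] := tree_formulas_grow g1 Ts.
have le_m1 : m <= size s1 := leq_trans le_m (leq_grow g1).
have szx : size x = 2 ^ e.
  by rewrite size_cat size_map size_enum_ord size_nseq subnKC.
have okx : all (usable s1) x.
  rewrite all_cat all_nseq usable_push // orbT andbT.
  by apply/allP => _ /mapP[l _ ->].
have cntx w : count (sat s1 w) x = votes T w i.
  rewrite count_cat count_nseq sat_last mul0n addn0 count_map votes_count.
  by apply: eq_count => l /=; rewrite valC.
have up_gt0 : 0 < uphalf n by rewrite uphalf_gt0.
have lt_n : (uphalf n).-1 < 2 ^ e.
  by rewrite prednK //; apply: leq_trans le_n; rewrite leq_uphalf_double; lia.
have := sortnetP le_m1 szx okx.
case: (sortnet e s1 x) => s2 y [g2 sz2 szy oky ty]; split.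
- exact: grow_trans g1 g2.
- by rewrite size_rcons in sz2; rewrite addnS.
- by apply: (all_nthP 0 oky); rewrite szy.
move=> w; have [_ /(_ (uphalf n).-1)] := ty w; rewrite szy => /(_ lt_n) ->.
rewrite cntx prednK //.
(* With two classes, voting for [j] is the same as not voting for [i]. Hence [i] wins or ties iff it
   gets at least [uphalf n] votes. *)
have votes2 j : j != i -> votes T w j + votes T w i = n.
  move=> ne_ji; apply: etrans (votes_neq T w i).
  rewrite addnC (votes_count _ _ j).
  congr (_ + _); apply: eq_count => l.
  move: (classify (T l) w) i j ne_ji {valC okC cntx x szx okx oky ty}.
  by rewrite k2 => -[[|[|//]] ?] [[|[|//]] ?] [[|[|//]] ?].
apply/idP/forallP => [le_i j|le_i].
  by have [->//|/votes2] := eqVneq j i; rewrite uphalfE in le_i *; lia.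
(* Comparing with the other class is what yields the lower bound on the votes for [i]. *)
have [j /votes2 def_n] : exists j, j != i.
  move: i {votes2 cntx x szx okx oky ty le_i}.
  rewrite k2; case=> [[|[|//]] ?]; first by exists (Ordinal (isT : 1 < 2)).
  by exists (Ordinal (isT : 0 < 2)).
by have := le_i j; rewrite uphalfE; lia.
Qed.

(** The size bound covers both branches: each loop step costs a sort and one conjunction, the final
    [2] pays for the two constants, and for [k = 2] the single shorter sort is cheaper than one loop
    step. *)
Lemma RFClassFormulaP i s : m <= size s -> tree_formulas s ->
  let: (s', r) := RFClassFormula s C N i in
  let e := up_log 2 n in
  [/\ grow s s',
      size s' <= size s + k * (2 ^ e.+1 * e.+1 ^ 2).+1 + 2, usable s' r
    & forall w, sat s' w r = belongs T w i].
Proof.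
move=> le_m Ts; rewrite /RFClassFormula; case: eqP => [k2|_].
  have := rf_twoP i k2 le_m Ts; set e := up_log 2 n.
  case: (rf_two s C i) => s' r [gs szs okr valr]; split=> //.
  apply: leq_trans szs _; rewrite k2 -addnA leq_add2l.
  apply: (@leq_trans (2 ^ e.+1 * e.+1 ^ 2).+1).
    by rewrite ltnS leq_mul ?leq_exp2l ?leq_exp2r.
  by rewrite mulSn mul1n -addnA leq_addr.
rewrite /=; set s1 := rcons s _; set s2 := rcons s1 _.
have g1 : grow s s1 by apply: grow_push.
have g2 : grow s1 s2 by apply: grow_push.
have g12 := grow_trans g1 g2.
have le_m1 : m <= size s1 := leq_trans le_m (leq_grow g1).
have le_m2 : m <= size s2 := leq_trans le_m1 (leq_grow g2).
have lt_f : size s < size s1 by rewrite size_rcons.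
have valf w : sat s2 w (size s) = false by rewrite (sat_grow w g2) // sat_last.
have := rf_loopP i [seq j <- enum 'I_k | j != i] le_m2
  (usable_grow g2 (usable_push _ le_m)) (usable_push _ le_m1) valf
  (tree_formulas_grow g12 Ts).
set js := filter _ _; set e := up_log 2 n.
case: (rf_loop _ _ _ _ _ _ _) => s' r [gs szs okr valr]; split=> //.
- exact: grow_trans g12 gs.
- apply: leq_trans szs _; rewrite !size_rcons -[(size s).+2]addn2 addnAC.
  rewrite leq_add2r leq_add2l leq_mul2r.
  by rewrite size_filter (leq_trans (count_size _ _)) ?size_enum_ord ?orbT.
move=> w; rewrite valr sat_last /=.
apply/allP/forallP => [le_i j|le_i j _]; last exact: le_i.
have [->//|ne_ji] := eqVneq j i.
by apply: le_i; rewrite mem_filter ne_ji mem_enum.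
Qed.

End Forest.
End Growth.

(** * Estimates for [up_log 2 n] *)

Lemma leq_exp_up_log n : 0 < n -> 2 ^ up_log 2 n <= 2 * n.
Proof.
case: n => [//|[_|n _]]; first by rewrite up_log1.
have /andP[/ltnW lo _] := up_log_bounds (isT : 1 < 2) (isT : 1 < n.+2).
by rewrite -(prednK (_ : 0 < up_log 2 n.+2)) ?up_log_gt0 // expnS leq_mul2l.
Qed.

Section Logarithm.
Local Open Scope ring_scope.
Variable R : realType.

Lemma half_le_ln2 : 1 / 2 <= ln 2 :> R.
Proof.
(* The bound [ln (1 + x) <= x] at [x = -1/2], where the left side is [- ln 2]. *)
have: ln (1 + - (1 / 2)) <= - (1 / 2) :> R by apply: le_ln1Dx; lra.
have -> : 1 + - (1 / 2) = 2^-1 :> R by lra.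
by rewrite lnV ?posrE //; lra.
Qed.

Lemma up_log_le_ln n : (0 < n)%N ->
  (up_log 2 n).+1%:R <= 2 + 2 * ln n%:R :> R.
Proof.
case: n => [//|[_|n _]]; first by rewrite up_log1 ln1; lra.
have /andP[/ltnW lo _] := up_log_bounds (isT : 1 < 2)%N (isT : 1 < n.+2)%N.
have e_gt0 : (0 < up_log 2 n.+2)%N by rewrite up_log_gt0.
(* From here [e] is the predecessor of the exponent, so [2 ^ e <= n.+2] and
   [e / 2 <= e * ln 2 <= ln n.+2]. *)
move: lo; rewrite -(prednK e_gt0) /=; move: (up_log 2 n.+2).-1 => e lo.
have: ln (2 ^+ e) <= ln n.+2%:R :> R.
  by rewrite ler_ln ?posrE ?exprn_gt0 ?ltr0n // -natrX ler_nat.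
rewrite lnXn // -[_ *+ e]mulr_natr => le_ln.
have le_e : 1 / 2 * e%:R <= ln 2 * e%:R :> R.
  by rewrite ler_wpM2r ?ler0n ?half_le_ln2.
rewrite -addn2 natrD; lra.
Qed.

End Logarithm.

(** * Correctness, NNF and size of the returned formula *)

Local Open Scope ring_scope.

(** The factor [a] expresses that negated class formulas have linear size; circuits have at least
    one node, so an additive constant could be absorbed in it. [K] depends only on [a], not on the
    forest. *)
Theorem mainTheorem1 (R : realType) (a : nat) :
  exists K : R,
  forall (V : finType) (D : V -> finType) (n k : nat)
         (T : 'I_n -> dtree D k) (s : dag D) (C N : 'I_k -> 'I_n -> nat),
    (forall X : V, (1 < #|D X|)%N) ->
    (0 < n)%N ->
    wf s ->
    (forall j l, formula_of s (C j l) (fun w => classify (T l) w == j)) ->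
    (forall j l, formula_of s (N j l) (fun w => classify (T l) w != j)) ->
    forall i : 'I_k,
      let s' := (RFClassFormula s C N i).1 in
      let r := (RFClassFormula s C N i).2 in
      [/\ wf s',
          formula_of s' r (fun w => belongs T w i),
          (forall j l, is_nnf s (C j l) && is_nnf s (N j l)) -> is_nnf s' r
        & (forall j l, (csize s (N j l) <= a * csize s (C j l))%N) ->
          (csize s' r)%:R <=
            K * ((\sum_(j < k) \sum_(l < n) csize s (C j l))%:R
                 + n%:R * k%:R * ln (n%:R : R) ^+ 2)].
Proof.
(* The final estimate is [(4 + a) * S + 4 * n * k * (8 + 8 * ln n ^ 2)]; with [n * k <= S], the
   coefficient of [S] becomes [36 + a], and that of the logarithmic term is [32]. *)
exists (36 + a%:R) => V D n k T s C N _ n_gt0 wfs valC valN i.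
pose F (u : 'I_k * 'I_n) := nodes s (C u.1 u.2) ++ nodes s (N u.1 u.2).
pose L := flatten [seq F u | u <- enum {: 'I_k * 'I_n}].
(* [L] lists the nodes of all given circuits, with repetitions for shared nodes; [Q] selects the
   nodes that reach nothing outside [L]. *)
pose Q p := all (mem L) (nodes s p).
have inL j l p : p \in F (j, l) -> p \in L.
  by move=> p_F; apply/flatten_mapP; exists (j, l); rewrite ?mem_enum.
have Ts : tree_formulas (size s) Q T C N s.
  split=> j l; try by [have [_] := valC j l | have [_] := valN j l].
    have [lt_C _] := valC j l; rewrite /usable lt_C /=; apply/orP; right.
    by apply/allP => p p_C; apply: (inL j l); rewrite mem_cat p_C.
  have [lt_N _] := valN j l; rewrite /usable lt_N /=; apply/orP; right.
  by apply/allP => p p_N; apply: (inL j l); rewrite mem_cat p_N orbT.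
have := RFClassFormulaP n_gt0 i (leqnn _) Ts.
case: (RFClassFormula s C N i) => s' r /= [gs szs okr valr].
have sub_r : {subset nodes s' r <= L ++ iota (size s) (size s' - size s)}.
  by apply: (nodes_bound (Q := Q)) okr => // p _ /allP.
split.
- exact: wf_grow gs wfs.
- by split=> //; case/andP: okr.
- move=> nnfs; apply/allP => p /sub_r p_r; apply/negP => /(gate_grow gs)[lt_p].
  move: p_r; rewrite mem_cat mem_iota leqNgt lt_p orbF.
  case/flatten_mapP => -[j l] _; have /andP[/allP nnfC /allP nnfN] := nnfs j l.
  by rewrite mem_cat => /orP[/nnfC|/nnfN] /negP.
move=> leNC; set S := (\sum_(j < k) _)%N.
have szL : (size L <= (1 + a) * S)%N.
  rewrite size_flatten /shape -map_comp sumnE big_map big_enum /=.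
  rewrite /S pair_bigA big_distrr leq_sum // => -[j l] _ /=.
  by rewrite size_cat mulnDl mul1n leq_add2l leNC.
have le_nkS : (n * k <= S)%N.
  rewrite mulnC -[X in (X * n)%N]card_ord -sum_nat_const leq_sum // => j _.
  rewrite -[X in (X <= _)%N]card_ord -sum1_card leq_sum // => l _.
  by have [/csize_gt0] := valC j l.
have le_r : (csize s' r <= size L + (size s' - size s))%N.
  rewrite -(size_iota (size s) (size s' - size s)) -size_cat.
  exact: uniq_leq_size (uniq_nodes _ _) sub_r.
have k_gt0 : (0 < k)%N by apply: leq_trans (ltn_ord i).
move: szs; set e := up_log 2 n => szs.
have le_e : (2 ^ e.+1 <= 4 * n)%N.
  by rewrite expnS -[4%N]/(2 * 2)%N -mulnA leq_mul2l leq_exp_up_log.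
have {le_r} le_r : (csize s' r <= (4 + a) * S + 4 * (n * k) * e.+1 ^ 2)%N.
  have le_p : (k * (2 ^ e.+1 * e.+1 ^ 2) <= 4 * (n * k) * e.+1 ^ 2)%N.
    by rewrite mulnA leq_mul2r orbC mulnC [(n * k)%N]mulnC; nia.
  (* Absorbs the [k] conjunctions and the two constants, which carry no logarithm and would not be
     covered by the second term when [n = 1]. *)
  have le_k : (k + 2 <= 3 * S)%N.
    by apply: leq_trans (_ : 3 * (n * k) <= _)%N; nia.
  have : (size s' - size s <= k * (2 ^ e.+1 * e.+1 ^ 2) + (k + 2))%N.
    by rewrite leq_subLR addnA (leq_trans szs) // mulnS; lia.
  move: le_p le_k szL le_r; rewrite !mulnDl.
  move: (k * (_ * _))%N (4 * (n * k) * e.+1 ^ 2)%N (a * S)%N => u v z.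
  lia.
have le_ln := up_log_le_ln R n_gt0; rewrite -/e in le_ln.
have le_sq : e.+1%:R ^+ 2 <= 8 + 8 * ln n%:R ^+ 2 :> R.
  apply: le_trans (_ : (2 + 2 * ln n%:R) ^+ 2 <= _).
    by rewrite lerXn2r ?nnegrE ?ler0n // (le_trans _ le_ln).
  (* With [x = ln n], the difference of the two sides is [4 * (1 - x) ^ 2]. *)
  by have := sqr_ge0 (1 - ln n%:R : R); rewrite !expr2; lra.
have le_nkR : n%:R * k%:R <= S%:R :> R by rewrite -natrM ler_nat.
have nk_ge0 : 0 <= n%:R * k%:R :> R by rewrite mulr_ge0.
have := ler_wpM2l nk_ge0 le_sq.
have: (csize s' r)%:R <=
    (4 + a%:R) * S%:R + 4 * (n%:R * k%:R) * e.+1%:R ^+ 2 :> R.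
  by rewrite -natrX -!natrM -natrD -natrM -natrD ler_nat.
have ln_ge0 : 0 <= n%:R * k%:R * ln n%:R ^+ 2 :> R.
  by rewrite mulr_ge0 ?sqr_ge0.
(* Together with [ln_ge0], this makes the slack [4 + a] in the coefficient of the logarithmic term
   available to linear arithmetic. *)
have a_ge0 : 0 <= a%:R * (n%:R * k%:R * ln n%:R ^+ 2) :> R.
  by rewrite mulr_ge0.
rewrite !mulrDr !mulrDl -!mulrA.
lra.
Qed.
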